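(* Let $\phi\in\mathcal O$ generate an exact Rayleigh branch, i.e. \[ F\bigl(\lambda_\phi(s),\mathcal G_s\phi\bigr)=0\quad\text{for all } s>0,\qquad \lambda_\phi(s):=\mathcal R(\mathcal G_s\phi). \] Assume that $\lambda_\phi$ is of class $C^2$ near some $s_*>0$ and \[ \lambda_\phi'(s_* )=0,\qquad \lambda_\phi''(s_* )\neq0 . \] Assume also that the orbit $s\mapsto\mathcal G_s\phi\in X$ is of class $C^1$ near $s_*$ and regular at $s_*$: \[ \left.\frac{d}{ds}\mathcal G_s\phi\right|_{s=s_*}\neq0 . \] Then $(\lambda_\phi^*,u_* )$, with $\lambda_\phi^*:=\lambda_\phi(s_* )$ and $u_*:=\mathcal G_{s_*}\phi$, is a nondegenerate turning point (turning bifurcation) of the exact Rayleigh branch. More precisely: - if $\lambda_\phi''(s_* )<0$, then there exists $\varepsilon>0$ such that for every $\lambda\in(\lambda_\phi^*-\varepsilon,\lambda_\phi^* )$ there are two distinct exact solutions $u_-(\lambda),u_+(\lambda)$ with $F(\lambda,u_\pm(\lambda))=0$ and $u_\pm(\lambda)\to u_*$ as $\lambda\uparrow\lambda_\phi^*$; - if $\lambda_\phi''(s_* )>0$, then there exists $\varepsilon>0$ such that for every $\lambda\in(\lambda_\phi^*,\lambda_\phi^*+\varepsilon)$ there are two distinct exact solutions $u_-(\lambda),u_+(\lambda)$ with $F(\lambda,u_\pm(\lambda))=0$ and $u_\pm(\lambda)\to u_*$ as $\lambda\downarrow\lambda_\phi^*$.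
   Context: $X,Y$ are (real) Banach spaces and $F:\mathbb R\times X\to Y$ is a map. Every nontrivial solution of $F(\lambda,u)=0$ is supposed to satisfy a scalar constraint that can be solved for the parameter, $\lambda=\mathcal R(u)$; the real-valued functional $\mathcal R$ is called the generalized Rayleigh functional. $\mathcal G_s:X\to X$, $s>0$, is a one-parameter family of transformations with $\mathcal G_1=\mathrm{Id}$, and $\mathcal O\subset X\setminus\{0\}$ is a class, on which $\mathcal R$ is defined, with $\mathcal G_s(\mathcal O)\subset\mathcal O$ for all $s>0$. A nondegenerate turning point (turning bifurcation) of the branch $s\mapsto(\lambda_\phi(s),\mathcal G_s\phi)$ is a point at which $\lambda_\phi'=0$, $\lambda_\phi''\ne0$ and two nearby solution states coalesce as the parameter reaches the critical value, in the precise sense spelled out in the two items of the claim. *)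

(* Defs.v *)
From mathcomp Require Import all_boot all_order all_algebra.
From mathcomp Require Import all_classical all_reals all_analysis.

Set Implicit Arguments.
Unset Strict Implicit.
Unset Printing Implicit Defensive.

Import Order.TTheory GRing.Theory Num.Theory.
Import numFieldNormedType.Exports.

Local Open Scope ring_scope.
Local Open Scope classical_set_scope.

Section RayleighBranch.
Context {R : realType} {X Y : completeNormedModType R}.

(* [derive1] is a junk value where the function is not derivable, hence the
   explicit derivability clauses. *)
Definition C1_near (V : normedModType R) (f : R -> V) (a : R) : Prop :=
  \forall s \near a, derivable f s 1 /\ {for s, continuous f^`()}.

Definition C2_near (V : normedModType R) (f : R -> V) (a : R) : Prop :=
  \forall s \near a,
    [/\ derivable f s 1, derivable f^`() s 1 & {for s, continuous f^`(2)}].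

(* A family of transformations is a function on all of [R], of which only the
   values at positive parameters are used; likewise a Rayleigh functional is a
   function on all of [X]. *)
Definition rayleigh_parameter (Ray : X -> R) (G : R -> X -> X) (phi : X)
  (s : R) : R := Ray (G s phi).

Definition exact_rayleigh_branch (F : R * X -> Y) (Ray : X -> R)
    (G : R -> X -> X) (phi : X) : Prop :=
  forall s : R, 0 < s -> F (rayleigh_parameter Ray G phi s, G s phi) = 0.

Definition distinct_solutions (F : R * X -> Y) (lam : R) (u v : X) : Prop :=
  [/\ u != v, F (lam, u) = 0 & F (lam, v) = 0].

Definition nondegenerate_turning_point (F : R * X -> Y) (Ray : X -> R)
    (G : R -> X -> X) (phi : X) (s0 : R) : Prop :=
  let lam := rayleigh_parameter Ray G phi in
  let lam0 := lam s0 in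
  let u0 := G s0 phi in
  [/\ lam^`() s0 = 0,
      lam^`(2) s0 != 0,
      lam^`(2) s0 < 0 ->
        exists2 e : R, 0 < e & exists um up : R -> X,
          [/\ forall l : R, lam0 - e < l < lam0 ->
                distinct_solutions F l (um l) (up l),
              um l @[l --> lam0^'-] --> u0 &
              up l @[l --> lam0^'-] --> u0]
    & 0 < lam^`(2) s0 ->
        exists2 e : R, 0 < e & exists um up : R -> X,
          [/\ forall l : R, lam0 < l < lam0 + e ->
                distinct_solutions F l (um l) (up l),
              um l @[l --> lam0^'+] --> u0 &
              up l @[l --> lam0^'+] --> u0]].

End RayleighBranch.

(* Main.v *)
Require Import Defs.
From mathcomp Require Import all_boot all_order all_algebra.
From mathcomp Require Import all_classical all_reals all_analysis.
From mathcomp Require Import lra.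

Set Implicit Arguments.
Unset Strict Implicit.
Unset Printing Implicit Defensive.

Import Order.TTheory GRing.Theory Num.Theory.
Import numFieldNormedType.Exports.

Local Open Scope ring_scope.
Local Open Scope classical_set_scope.

(** The branch folds because its parameter lam s = Ray (G s phi) has a
nondegenerate extremum at s0, and the two arcs of the orbit on the two sides
of s0 are kept apart by the nonzero velocity of the orbit.

Since lam' vanishes at s0 and has derivative lam'' s0 <> 0 there, lam' takes
opposite signs on the two sides of s0
([near_pos_neg_of_derive1_lt0], [near_neg_pos_of_derive1_gt0]).  Say
lam'' s0 < 0.  Then lam increases strictly on an interval ending at s0 and
decreases strictly on an interval starting at s0, so by the intermediate value
theorem each value l slightly below lam s0 is attained once on each side, at
parameters sm l < s0 < sp l; strict monotonicity forces both to tend to s0 as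
l tends to lam s0 ([left_inverse_branch], [fold_at_local_max]).  The case
lam'' s0 > 0 is the same statement for - lam ([fold_at_local_min]).

The states G (sm l) phi and G (sp l) phi solve the equation at
lam (sm l) = lam (sp l) = l, and continuity of the orbit makes them tend to
G s0 phi.  They are distinct because sm l and sp l straddle s0: if v is the
velocity at s0, a difference g t - g s with s < s0 < t equals (t - s) v up to
an error which is small compared with (s0 - s) + (t - s0) = t - s, so it cannot
vanish ([regular_separates_sides]). *)

(** * First-order behaviour at a point *)

(** The first-order expansion in a form that also covers s = a, with an
explicit error constant to be compared with the size of the derivative. *)
Lemma derivable_near_affine (R : realType) (V : normedModType R) (g : R -> V)
    (a e : R) : derivable g a 1 -> 0 < e ->
  \forall s \near a, `|g s - g a - (s - a) *: g^`()%classic a| <= e * `|s - a|.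
Proof.
move=> dg e0.
have cg : h^-1 *: (g (h + a) - g a) @[h --> 0^'] --> g^`()%classic a.
  rewrite derive1E; move: dg; rewrite /derivable /derive /=.
  by under eq_fun do rewrite /= [_%:A]mulr1.
have : \forall h \near (0 : R)^',
    `|g^`()%classic a - h^-1 *: (g (h + a) - g a)| <= e.
  by move/cvgrPdist_le : cg; exact.
move=> /nbhs_ballP[d /= d0 Hd].
apply/nbhs_ballP; exists d => //= s sd.
(* the difference quotient says nothing at s = a, where both sides vanish *)
have [->|sa] := eqVneq s a; first by rewrite !subrr scale0r subrr !normr0 mulr0.
have sa0 : s - a != 0 by rewrite subr_eq0.
have := Hd (s - a); rewrite /ball /= sub0r normrN subrK => /(_ _ sa0).
move: sd; rewrite /ball /= distrC => sd /(_ sd) H.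
have -> : g s - g a - (s - a) *: g^`()%classic a =
    - ((s - a) *: (g^`()%classic a - (s - a)^-1 *: (g s - g a))).
  by rewrite scalerBr scalerA mulfV// scale1r opprB.
by rewrite normrN normrZ mulrC ler_wpM2r.
Qed.

(** Near a the map s |-> g s - s v, with v the derivative of g at a, differs from
its value at a by at most |v| / 2 times the distance to a.  For s < a < t the two distances add up
to t - s, so the term (t - s) v dominates the errors and g s <> g t.  Local
injectivity can fail for such a g, since two points on the same side of a are
not controlled. *)
Lemma regular_separates_sides (R : realType) (V : normedModType R) (g : R -> V)
    (a : R) : derivable g a 1 -> g^`()%classic a != 0 ->
  \forall p \near (a, a), p.1 < a < p.2 -> g p.1 != g p.2.
Proof.
move=> dg v0; set v := g^`()%classic a in v0.
(* any factor below 1 in front of the norm of v would do *)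
have v2 : 0 < `|v| / 2 by rewrite divr_gt0// normr_gt0.
have H := derivable_near_affine dg v2.
exists ([set s | `|g s - g a - (s - a) *: v| <= `|v| / 2 * `|s - a|],
        [set s | `|g s - g a - (s - a) *: v| <= `|v| / 2 * `|s - a|]) => //=.
move=> [s t] /= [Hs Ht] /andP[sa at_]; apply/eqP => gst.
have st : 0 < t - s by rewrite subr_gt0 (lt_trans sa).
have E : (t - s) *: v =
    (g s - g a - (s - a) *: v) - (g t - g a - (t - a) *: v).
  rewrite gst [RHS]addrC opprB addrA subrK -scalerBl.
  by congr (_ *: _); rewrite opprB addrA subrK.
have : `|(t - s) *: v| <= `|v| / 2 * (t - s).
  rewrite E (le_trans (ler_normB _ _))// (le_trans (lerD Hs Ht))//.
  rewrite (@ltr0_norm _ (s - a)) ?(@gtr0_norm _ (t - a)) ?subr_lt0 ?subr_gt0//.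
  by lra.
rewrite normrZ gtr0_norm// mulrC ler_pM2r//.
have v_gt0 : 0 < `|v| by rewrite normr_gt0.
by lra.
Qed.

Lemma near_pos_neg_of_derive1_lt0 (R : realType) (g : R -> R) (a : R) :
  derivable g a 1 -> g a = 0 -> g^`()%classic a < 0 ->
  (\forall s \near a^'-, 0 < g s) /\ (\forall s \near a^'+, g s < 0).
Proof.
move=> dg ga0 g'a.
have e0 : 0 < - g^`()%classic a / 2 by rewrite divr_gt0// oppr_gt0.
have H := derivable_near_affine dg e0.
split; rewrite near_withinE; apply: filterS H => s + sa; rewrite ga0 subr0.
  rewrite (@ltr0_norm _ (s - a)) ?subr_lt0// ler_norml /= => /andP[+ _].
  by rewrite /GRing.scale/=; nra.
rewrite (@gtr0_norm _ (s - a)) ?subr_gt0// ler_norml /= => /andP[_].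
by rewrite /GRing.scale/=; nra.
Qed.

Lemma near_neg_pos_of_derive1_gt0 (R : realType) (g : R -> R) (a : R) :
  derivable g a 1 -> g a = 0 -> 0 < g^`()%classic a ->
  (\forall s \near a^'-, g s < 0) /\ (\forall s \near a^'+, 0 < g s).
Proof.
move=> dg ga0 g'a.
have [|||gm gp] := @near_pos_neg_of_derive1_lt0 R (- g) a.
- exact: derivableN.
- by rewrite opprfctE ga0 oppr0.
- by rewrite derive1N// oppr_lt0.
by split; [apply: filterS gm => s /=; rewrite oppr_gt0|
  apply: filterS gp => s /=; rewrite oppr_lt0].
Qed.

(** * Inverse branches on the two sides of an extremum *)

(** Strict monotonicity gives more than an inverse: f s < l forces s < t l, so
the preimage of l is squeezed against a when l approaches f a. *)
Lemma left_inverse_branch (R : realType) (f : R -> R) (c a : R) : c < a ->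
  {within `[c, a], continuous f} ->
  {in `[c, a]%R &, {homo f : x y / x < y}} ->
  exists t : R -> R,
    (\forall l \near (f a)^'-, t l < a /\ f (t l) = l) /\
    t l @[l --> (f a)^'-] --> a.
Proof.
move=> ca cf incf.
have ivt (s l : R) : s \in `[c, a]%R -> f s < l < f a ->
    exists t, s < t < a /\ f t = l.
  rewrite in_itv/= => /andP[cs sa] /andP[sl la].
  have cfs : {within `[s, a], continuous f}.
    by apply: continuous_subspaceW cf; apply: subset_itv; rewrite bnd_simp.
  have [|t] := IVT sa cfs (v := l).
    by rewrite ge_min (ltW sl)/= le_max (ltW la) orbT.
  rewrite in_itv/= => /andP[st ta] ftl; exists t.
  rewrite !lt_neqAle st ta !andbT; split=> //.
  by apply/andP; split; apply/eqP => E; move: sl la; rewrite -ftl E ltxx.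
(* the default value a is only taken at levels outside ]f c, f a[ *)
pose t l := xget a [set s | c < s < a /\ f s = l].
have tP l : f c < l < f a -> c < t l < a /\ f (t l) = l.
  move=> fl; apply: (@xgetPex _ a [set s | c < s < a /\ f s = l]).
  by apply: ivt => //; rewrite in_itv/= lexx ltW.
have fca : f c < f a by apply: incf; rewrite // in_itv/= lexx ltW.
exists t; split.
  near=> l; have [|/andP[_ ->] ->//] := tP l.
  apply/andP; split; near: l; [exact: nbhs_left_gt|exact: nbhs_left_lt].
apply/cvgrPdist_lt => e e0.
(* a point of [c, a[ closer to a than e *)
pose s := Num.max c (a - e / 2).
have sca : s \in `[c, a]%R.
  by rewrite in_itv/= le_max lexx/= ge_max (ltW ca)/=; lra.
have sa : s < a by rewrite gt_max ca/=; lra.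
have fsa : f s < f a by apply: incf; rewrite // in_itv/= lexx ltW.
near=> l.
have fsl : f s < l by near: l; exact: nbhs_left_gt.
have [|/andP[ct ta] ftl] := tP l.
  apply/andP; split; near: l; [exact: nbhs_left_gt|exact: nbhs_left_lt].
have st : s < t l.
  rewrite ltNge; apply/negP; rewrite le_eqVlt => /predU1P[tl|tl].
    by move: fsl; rewrite -tl ftl ltxx.
  have : f (t l) < f s by apply: incf; rewrite // in_itv/= !ltW.
  by rewrite ftl ltNge (ltW fsl).
rewrite gtr0_norm ?subr_gt0//.
have : a - e / 2 <= s by rewrite le_max lexx orbT.
lra.
Unshelve. all: by end_near. Qed.

(** The mirror image of [left_inverse_branch] under s |-> - s. *)
Lemma right_inverse_branch (R : realType) (f : R -> R) (a c : R) : a < c ->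
  {within `[a, c], continuous f} ->
  {in `[a, c]%R &, {homo f : x y /~ x < y}} ->
  exists t : R -> R,
    (\forall l \near (f a)^'-, a < t l /\ f (t l) = l) /\
    t l @[l --> (f a)^'-] --> a.
Proof.
move=> ac cf decf.
have [|||t []] := @left_inverse_branch R (f \o -%R) (- c) (- a).
- by rewrite ltrN2.
- by apply: within_continuous_compN; rewrite !opprK.
- move=> x y xca yca xy; apply: decf; rewrite ?ltrN2//.
    by rewrite oppr_itvcc.
  by rewrite oppr_itvcc.
rewrite /= opprK => tP ta; exists (fun l => - t l); split.
  by apply: filterS tP => l [tl ftl]; split; [rewrite ltrNr|].
by rewrite -[X in _ --> X]opprK; exact: cvgN.
Qed.

(** The sign of the derivative makes f strictly monotone on each side of a, so
each side carries its own inverse branch with values tending to a. *)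
Lemma fold_at_local_max (R : realType) (f : R -> R) (a : R) :
  (\forall s \near a, derivable f s 1) ->
  (\forall s \near a^'-, 0 < f^`()%classic s) ->
  (\forall s \near a^'+, f^`()%classic s < 0) ->
  exists sm sp : R -> R,
    [/\ \forall l \near (f a)^'-,
          [/\ sm l < a < sp l, f (sm l) = l & f (sp l) = l],
        sm l @[l --> (f a)^'-] --> a & sp l @[l --> (f a)^'-] --> a].
Proof.
move=> /nbhs_ballP[d1 /= d10 df] /nbhs_ballP[d2 /= d20 dfm].
move=> /nbhs_ballP[d3 /= d30 dfp].
(* halving makes the closed interval [a - d, a + d] fit in the open balls *)
pose d := Num.min d1 (Num.min d2 d3) / 2.
have d0 : 0 < d by rewrite divr_gt0// !lt_min d10 d20.
have [dd1 dd2 dd3] : [/\ d < d1, d < d2 & d < d3].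
  have : Num.min d1 (Num.min d2 d3) <= d1 by rewrite ge_min lexx.
  have : Num.min d1 (Num.min d2 d3) <= d2 by rewrite !ge_min lexx orbT.
  have : Num.min d1 (Num.min d2 d3) <= d3 by rewrite !ge_min lexx !orbT.
  have : 0 < Num.min d1 (Num.min d2 d3) by rewrite !lt_min d10 d20.
  by rewrite /d => *; split; lra.
have {}df s : a - d <= s <= a + d -> derivable f s 1.
  move=> /andP[? ?]; apply: df; rewrite /ball /=.
  by rewrite ltr_distlC; apply/andP; split; lra.
have [|||sm [smP sma]] := @left_inverse_branch R f (a - d) a.
- by lra.
- apply: derivable_within_continuous => s; rewrite in_itv/= => /andP[? ?].
  by apply: df; lra.
- apply: gtr0_derive1_lt_cc => [s|s|].
  + by rewrite in_itv/= => /andP[? ?]; apply: df; lra.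
  + rewrite in_itv/= => /andP[? ?]; apply: dfm => //.
    by rewrite /ball /= ltr_distlC; apply/andP; split; lra.
  + apply: derivable_within_continuous => s; rewrite in_itv/= => /andP[? ?].
    by apply: df; lra.
have [|||sp [spP spa]] := @right_inverse_branch R f a (a + d).
- by lra.
- apply: derivable_within_continuous => s; rewrite in_itv/= => /andP[? ?].
  by apply: df; lra.
- apply: ltr0_derive1_lt_cc => [s|s|].
  + by rewrite in_itv/= => /andP[? ?]; apply: df; lra.
  + rewrite in_itv/= => /andP[? ?]; apply: dfp => //.
    by rewrite /ball /= ltr_distlC; apply/andP; split; lra.
  + apply: derivable_within_continuous => s; rewrite in_itv/= => /andP[? ?].
    by apply: df; lra.
exists sm, sp; split => //.
near=> l.
have [? ?] : sm l < a /\ f (sm l) = l by near: l.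
have [? ?] : a < sp l /\ f (sp l) = l by near: l.
by split => //; apply/andP.
Unshelve. all: by end_near. Qed.

Lemma fold_at_local_min (R : realType) (f : R -> R) (a : R) :
  (\forall s \near a, derivable f s 1) ->
  (\forall s \near a^'-, f^`()%classic s < 0) ->
  (\forall s \near a^'+, 0 < f^`()%classic s) ->
  exists sm sp : R -> R,
    [/\ \forall l \near (f a)^'+,
          [/\ sm l < a < sp l, f (sm l) = l & f (sp l) = l],
        sm l @[l --> (f a)^'+] --> a & sp l @[l --> (f a)^'+] --> a].
Proof.
move=> df dfm dfp.
have [|||sm [sp [sP sma spa]]] := @fold_at_local_max R (- f) a; last 1 first.
- have compNN (t : R -> R) : (t \o -%R) \o -%R = t.
    by apply/funext => l /=; rewrite opprK.
  exists (sm \o -%R), (sp \o -%R); split.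
  + have {}sP : \forall l \near (f a)^'+, [/\ sm (- l) < a < sp (- l),
        - f (sm (- l)) = - l & - f (sp (- l)) = - l].
      by move: sP; rewrite opprfctE at_leftN.
    by apply: filterS sP => l [? /oppr_inj ? /oppr_inj].
  + by apply/cvg_at_rightNP; rewrite compNN.
  + by apply/cvg_at_rightNP; rewrite compNN.
- by apply: filterS df => s; exact: derivableN.
- have dfl : \forall s \near a^'-, derivable f s 1.
    by rewrite near_withinE; apply: filterS df.
  by near=> s; rewrite derive1N ?oppr_gt0; near: s.
- have dfr : \forall s \near a^'+, derivable f s 1.
    by rewrite near_withinE; apply: filterS df.
  by near=> s; rewrite derive1N ?oppr_lt0; near: s.
Unshelve. all: by end_near. Qed.

(** * Solutions on the two arcs of the orbit *)

(** The filter H stands for the one-sided neighbourhoods of the critical value: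
from below at a maximum of the parameter, from above at a minimum. *)
Lemma distinct_solutions_of_fold (R : realType) (X Y : completeNormedModType R)
    (F : R * X -> Y) (Ray : X -> R) (G : R -> X -> X) (phi : X) (s0 : R)
    (H : set_system R) (FH : Filter H) (sm sp : R -> R) :
  exact_rayleigh_branch F Ray G phi -> 0 < s0 ->
  derivable (fun s : R => G s phi) s0 1 ->
  (fun s : R => G s phi)^`()%classic s0 != 0 ->
  (\forall l \near H, [/\ sm l < s0 < sp l,
     rayleigh_parameter Ray G phi (sm l) = l &
     rayleigh_parameter Ray G phi (sp l) = l]) ->
  sm l @[l --> H] --> s0 -> sp l @[l --> H] --> s0 ->
  [/\ \forall l \near H, distinct_solutions F l (G (sm l) phi) (G (sp l) phi),
      G (sm l) phi @[l --> H] --> G s0 phi &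
      G (sp l) phi @[l --> H] --> G s0 phi].
Proof.
move=> branch s0_gt0 dG regG sP sm0 sp0.
have cG : {for s0, continuous (fun s => G s phi)}.
  by apply: differentiable_continuous; exact/derivable1_diffP.
split; last 2 first.
- exact: (@continuous_cvg _ _ _ _ _ _ (fun s => G s phi)) cG sm0.
- exact: (@continuous_cvg _ _ _ _ _ _ (fun s => G s phi)) cG sp0.
have sep : \forall l \near H, sm l < s0 < sp l -> G (sm l) phi != G (sp l) phi.
  exact: (cvg_pair sm0 sp0) (regular_separates_sides dG regG).
(* the branch equation is only available at positive parameters *)
have sm_gt0 : \forall l \near H, 0 < sm l by exact: cvgr_gt sm0 _ s0_gt0.
have sp_gt0 : \forall l \near H, 0 < sp l by exact: cvgr_gt sp0 _ s0_gt0.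
apply: filterS3 (filterI sP sep) sm_gt0 sp_gt0 => l [[s0l sml spl] /(_ s0l) ?].
move=> /branch + /branch; rewrite sml spl => ? ?.
by split.
Qed.

Theorem theorem2p1 (R : realType) (X Y : completeNormedModType R)
    (F : R * X -> Y) (Ray : X -> R) (G : R -> X -> X) (O : set X)
    (Ray_constraint : forall (l : R) (u : X), u != 0 -> F (l, u) = 0 -> l = Ray u)
    (G_id : forall u : X, G 1 u = u)
    (O_nontrivial : forall u : X, O u -> u != 0)
    (G_stable : forall (s : R) (u : X), 0 < s -> O u -> O (G s u))
    (phi : X) (phi_O : O phi)
    (branch : exact_rayleigh_branch F Ray G phi)
    (s0 : R) (s0_gt0 : 0 < s0)
    (lam_C2 : C2_near (rayleigh_parameter Ray G phi) s0)
    (lam_crit : (rayleigh_parameter Ray G phi)^`() s0 = 0)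
    (lam_nondeg : (rayleigh_parameter Ray G phi)^`(2) s0 != 0)
    (orbit_C1 : C1_near (fun s : R => G s phi) s0)
    (orbit_regular : (fun s : R => G s phi)^`() s0 != 0) :
  nondegenerate_turning_point F Ray G phi s0.
Proof.
have dlam : \forall s \near s0, derivable (rayleigh_parameter Ray G phi) s 1.
  by apply: filterS lam_C2 => s [].
have [_ ddlam _] := nbhs_singleton lam_C2.
have [dG _] := nbhs_singleton orbit_C1.
split => // [lam2_lt0|lam2_gt0].
- have [dlam_gt0 dlam_lt0] :=
    near_pos_neg_of_derive1_lt0 ddlam lam_crit lam2_lt0.
  have [sm [sp [sP sm0 sp0]]] := fold_at_local_max dlam dlam_gt0 dlam_lt0.
  have [sol um0 up0] :=
    distinct_solutions_of_fold _ branch s0_gt0 dG orbit_regular sP sm0 sp0.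
  have /nbhs_ballP[e /= e0 solP] := sol.
  exists e => //; exists (fun l => G (sm l) phi), (fun l => G (sp l) phi).
  split => // l /andP[el l0]; apply: solP => //.
  by rewrite /ball /= gtr0_norm ?subr_gt0// ltrBlDr -ltrBlDl.
- have [dlam_lt0 dlam_gt0] :=
    near_neg_pos_of_derive1_gt0 ddlam lam_crit lam2_gt0.
  have [sm [sp [sP sm0 sp0]]] := fold_at_local_min dlam dlam_lt0 dlam_gt0.
  have [sol um0 up0] :=
    distinct_solutions_of_fold _ branch s0_gt0 dG orbit_regular sP sm0 sp0.
  have /nbhs_ballP[e /= e0 solP] := sol.
  exists e => //; exists (fun l => G (sm l) phi), (fun l => G (sp l) phi).
  split => // l /andP[l0 le]; apply: solP => //.
  by rewrite /ball /= distrC gtr0_norm ?subr_gt0// ltrBlDl.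
Qed.
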